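(* Let $\mathcal{G}=(\mathcal{V},\mathcal{A})$ be a directed network with $n_v$ nodes, $n_a$ arcs and node-arc incidence matrix $T\in\{-1,0,1\}^{n_v\times n_a}$, and let $\delta\in\mathbb{R}_+^{n_v}$. For $x\in\{0,1\}^{n_v}$ define $$\phi(x)=\min_{y\in\mathbb{R}^{n_a}}\left\{c^\top y:\ Ty\ge d+\mathrm{diag}(\delta)x,\ 0\le y\le f\right\}.$$ Then $\phi$ is supermodular on $\{0,1\}^{n_v}$ for all $c\in\mathbb{R}^{n_a}$, $d\in\mathbb{R}^{n_v}$ and $f\in\mathbb{R}_+^{n_a}$.
   Context: Incidence matrix: the entry $t_{ij}$ of $T$ equals $-1$ if node $i$ is the tail of arc $j$, $+1$ if node $i$ is the head of arc $j$, and $0$ otherwise. A function $\phi$ on a sublattice $X\subseteq\mathbb{R}^n$ is supermodular if $\phi(x')+\phi(x'')\le\phi(x'\vee x'')+\phi(x'\wedge x'')$ for all $x',x''\in X$, with $\vee,\wedge$ the componentwise maximum and minimum. Standing assumption (complete recourse): parameters are such that for every $x$ in the domain the minimization problem is feasible and bounded, so $\phi(x)$ is finite; ''for all $c,d,f$'' ranges over such parameters. *)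

(* Defs.v *)
From HB Require Import structures.
From mathcomp Require Import all_boot all_order all_algebra.
From mathcomp Require Import boolp classical_sets reals.

Set Implicit Arguments.
Unset Strict Implicit.
Unset Printing Implicit Defensive.

Import Order.TTheory GRing.Theory Num.Theory.

Local Open Scope classical_set_scope.
Local Open Scope ring_scope.

(* Parallel arcs are allowed. Self-loops are excluded: the tail and the head
   of an arc must receive different entries in its incidence column. *)
Record network (nv na : nat) := Network {
  arc_tail : 'I_na -> 'I_nv;
  arc_head : 'I_na -> 'I_nv;
  arc_tail_neq_head : forall a, arc_tail a != arc_head a }.

Definition incidence (R : pzRingType) nv na (G : network nv na) :
    'M[R]_(nv, na) :=
  \matrix_(i, j) (if i == arc_tail G j then -1
                    else if i == arc_head G j then 1 else 0).

Definition vec_le (R : realType) n (u v : 'cV[R]_n) : Prop :=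
  forall i, u i 0 <= v i 0.

Definition vec_join (R : realType) n (u v : 'cV[R]_n) : 'cV[R]_n :=
  map2_mx Num.max u v.

Definition vec_meet (R : realType) n (u v : 'cV[R]_n) : 'cV[R]_n :=
  map2_mx Num.min u v.

Definition sublattice (R : realType) n (X : set 'cV[R]_n) : Prop :=
  forall x' x'', X x' -> X x'' -> X (vec_join x' x'') /\ X (vec_meet x' x'').

(* Meant for a sublattice X; phi is total, but only its values on X matter. *)
Definition supermodular (R : realType) n (X : set 'cV[R]_n)
    (phi : 'cV[R]_n -> R) : Prop :=
  forall x' x'', X x' -> X x'' ->
    phi x' + phi x'' <= phi (vec_join x' x'') + phi (vec_meet x' x'').

Definition binary_cube (R : realType) n : set 'cV[R]_n :=
  [set x | forall i, x i 0 = 0 \/ x i 0 = 1].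

Lemma binary_cube_sublattice (R : realType) n : sublattice (@binary_cube R n).
Proof.
move=> x' x'' X' X''; split=> i; rewrite mxE;
  by case: (leP (x' i 0) (x'' i 0)) => _; [case: (X' i) | case: (X'' i)] => h;
     (by [left | right]) || (case: (X' i); case: (X'' i); by [left | right]).
Qed.

(* The least element of A, with the junk value 0 when A has none. *)
Definition minimum (R : realType) (A : set R) : R := xget 0 (A `&` lbound A).

Definition feasible (R : realType) nv na (T : 'M[R]_(nv, na))
    (delta d : 'cV[R]_nv) (f : 'cV[R]_na) (x : 'cV[R]_nv) : set 'cV[R]_na :=
  [set y | [/\ vec_le (d + diag_mx delta^T *m x) (T *m y),
               vec_le 0 y & vec_le y f]].

Definition costs (R : realType) nv na (T : 'M[R]_(nv, na))
    (delta d : 'cV[R]_nv) (c f : 'cV[R]_na) (x : 'cV[R]_nv) : set R :=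
  [set (c^T *m y) 0 0 | y in feasible T delta d f x].

Definition phi (R : realType) nv na (T : 'M[R]_(nv, na))
    (delta d : 'cV[R]_nv) (c f : 'cV[R]_na) (x : 'cV[R]_nv) : R :=
  minimum (costs T delta d c f x).

(* has_inf says that the problem is feasible (the set of costs is nonempty)
   and bounded (that set has a lower bound). *)
Definition complete_recourse (R : realType) nv na (T : 'M[R]_(nv, na))
    (delta d : 'cV[R]_nv) (c f : 'cV[R]_na) (X : set 'cV[R]_nv) : Prop :=
  forall x, X x -> has_inf (costs T delta d c f x).

(* Main.v *)
Require Import Defs.
From HB Require Import structures.
From mathcomp Require Import all_boot all_order all_algebra.
From mathcomp Require Import boolp classical_sets reals.
From mathcomp Require Import topology normedtype derive.
From mathcomp Require Import ring lra.

(** Write [b = d + diag(delta) x] for the demand vector. Let [y1] and [y2] be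
    optimal flows for the join and the meet of [x'] and [x'']. Supermodularity
    follows once [y1 + y2] is rewritten as [y' + y''] with [y'] feasible for
    [x'] and [y''] feasible for [x''], because the objective is linear.

    Take [y' = y2 + w] and [y'' = y1 - w], where [w] is a part of the flow
    difference [z = y1 - y2] that runs along [z]: every [w a] lies between [0]
    and [z a], so the capacities are respected. Decompose [z] into paths, each
    running from a node with negative net inflow [(T z) i] to one with positive
    net inflow, and cycles. Let [w] collect the paths that end in the set [S]
    of nodes where [x'' < x']. At a node of [S] with nonnegative net inflow [w]
    has the whole net inflow of [z], so there [y'] inherits the balance of [y1]
    and [y''] that of [y2]; at such a node outside [S] the two are exchanged.
    At a node with negative net inflow, both [y'] and [y''] are at least as
    well supplied as [y1], which meets the larger demand since [delta >= 0].

    The path decomposition itself is avoided ([exists_conformal_part]): only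
    the fraction of the flow through each node that ends up in [S] matters, and
    these fractions solve a monotone fixed point equation on a cube [0, 1]^n,
    to which the Knaster-Tarski argument applies ([unit_cube_fixpoint]).

    The minimum that defines [phi] is attained because the feasible set is a
    closed subset of a box ([phi_attained]). *)

Set Implicit Arguments.
Unset Strict Implicit.
Unset Printing Implicit Defensive.

Import Order.TTheory GRing.Theory Num.Theory.
Import numFieldNormedType.Exports.

Local Open Scope classical_set_scope.
Local Open Scope ring_scope.

(** * Attainment of the minimum *)

Lemma continuous_lincomb (R : realType) (T : topologicalType) (I : Type)
    (s : seq I) (a : I -> R) (g : I -> T -> R) :
  (forall i, continuous (g i)) -> continuous (fun x => \sum_(i <- s) a i * g i x).
Proof.
move=> g_cont; elim: s => [|i s IHs] x.
  by under eq_fun do rewrite big_nil; exact: cst_continuous.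
under eq_fun do rewrite big_cons.
by apply: cvgD; [apply: cvgMl_tmp; exact: g_cont | exact: IHs].
Qed.

Lemma continuous_mulmx_trmx (R : realType) m n (M : 'M[R]_(m, n)) i :
  continuous (fun v : 'rV[R]_n => (M *m v^T) i 0).
Proof.
have -> : (fun v : 'rV[R]_n => (M *m v^T) i 0) =
          (fun v => \sum_(j < n) M i j * v 0 j).
  by apply/funext => v; rewrite mxE; apply: eq_bigr => j _; rewrite mxE.
by apply: continuous_lincomb => j; exact: coord_continuous.
Qed.

(** The feasible flows form a closed part of the box between [0] and [f]; they
    are read as row vectors so that [rV_compact] applies to this box. *)
Lemma compact_feasible (R : realType) nv na (T : 'M[R]_(nv, na))
    (delta d : 'cV[R]_nv) (f : 'cV[R]_na) (x : 'cV[R]_nv) :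
  compact [set v : 'rV[R]_na | feasible T delta d f x v^T].
Proof.
set b := d + diag_mx delta^T *m x.
have boxP : compact [set v : 'rV[R]_na | forall i, [set` `[0, f i 0]] (v 0 i)].
  by apply: (@rV_compact _ _ (fun i => [set` `[0, f i 0]])) => i; exact: segment_compact.
have demandP : closed (\bigcap_(i in [set: 'I_nv])
    [set v : 'rV[R]_na | b i 0 <= (T *m v^T) i 0]).
  apply: closed_bigI => i _.
  apply: (@preimage_closed _ _ (fun v : 'rV[R]_na => (T *m v^T) i 0)
            [set t | b i 0 <= t]); last exact: closed_ge.
  by move=> v _; exact: continuous_mulmx_trmx.
have -> : [set v : 'rV[R]_na | feasible T delta d f x v^T] =
    \bigcap_(i in [set: 'I_nv]) [set v : 'rV[R]_na | b i 0 <= (T *m v^T) i 0]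
      `&` [set v : 'rV[R]_na | forall i, [set` `[0, f i 0]] (v 0 i)].
  apply/seteqP; split=> v /=.
    case=> Tv v0 vf; split=> [i _|i]; first exact: Tv.
    by rewrite /= in_itv /=; move: (v0 i) (vf i); rewrite !mxE => -> ->.
  case=> Tv vf; split=> i; first exact: Tv.
    by move: (vf i); rewrite /= in_itv /= !mxE => /andP[].
  by move: (vf i); rewrite /= in_itv /= !mxE => /andP[].
by rewrite setIC; exact: compact_closedI.
Qed.

(** The cost is continuous on a compact set, so the set of costs has a least
    element and the default value of [minimum] is never taken. *)
Lemma phi_attained (R : realType) nv na (T : 'M[R]_(nv, na))
    (delta d : 'cV[R]_nv) (c f : 'cV[R]_na) (x : 'cV[R]_nv) :
  feasible T delta d f x !=set0 ->
  [/\ exists2 y, feasible T delta d f x y & phi T delta d c f x = (c^T *m y) 0 0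
    & forall y, feasible T delta d f x y -> phi T delta d c f x <= (c^T *m y) 0 0].
Proof.
case=> y0 y0P.
have A0 : [set v : 'rV[R]_na | feasible T delta d f x v^T] !=set0.
  by exists y0^T; rewrite /= trmxK.
have cont : {within [set v : 'rV[R]_na | feasible T delta d f x v^T],
             continuous (fun v => (c^T *m v^T) 0 0)}.
  by apply: continuous_subspaceT; exact: continuous_mulmx_trmx.
have [v /set_mem /= vP vmin] :=
  compact_EVT_min A0 (@compact_feasible _ _ _ T delta d f x) cont.
have vE : (costs T delta d c f x `&` lbound (costs T delta d c f x))
            ((c^T *m v^T) 0 0).
  split; first by exists v^T.
  move=> _ [y yP <-]; rewrite -[y]trmxK; apply: vmin.
  by apply/mem_set; rewrite /= trmxK.
rewrite /phi /minimum; have [[y yP yE] lb] := xgetPex 0 (ex_intro _ _ vE).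
split=> [|y' y'P]; first by exists y.
by apply: lb; exists y'.
Qed.

(** * Splitting a flow along its paths *)

(** The Knaster-Tarski argument: the pointwise supremum of the points [r] of
    the cube with [r <= F r] is a fixed point. *)
Lemma unit_cube_fixpoint (R : realType) (I : Type) (F : (I -> R) -> I -> R) :
  (forall r, (forall i, 0 <= r i <= 1) -> forall i, 0 <= F r i <= 1) ->
  (forall r s, (forall i, r i <= s i) -> forall i, F r i <= F s i) ->
  exists2 r, (forall i, 0 <= r i <= 1) & forall i, F r i = r i.
Proof.
move=> Fcube Fmono.
pose P := [set r : I -> R | (forall i, 0 <= r i <= 1) /\
                            forall i, r i <= F r i].
pose r i := sup [set s i | s in P].
have P0 : P (fun=> 0).
  have cube0 : forall i : I, 0 <= (0 : R) <= 1 by move=> _; rewrite lexx ler01.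
  by split=> // i; case/andP: (Fcube _ cube0 i).
have P_ub i : ubound [set s i | s in P] 1.
  by move=> _ [s [s01 _] <-]; case/andP: (s01 i).
have r_ub s i : P s -> s i <= r i.
  by move=> Ps; apply: ub_le_sup; [exists 1 | exists s].
have r_le m i : (forall s, P s -> s i <= m) -> r i <= m.
  move=> sm; apply: ge_sup; first by exists 0, (fun=> 0).
  by move=> _ [s Ps <-]; exact: sm.
have r01 i : 0 <= r i <= 1.
  by rewrite (r_ub _ i P0) r_le// => s [s01 _]; case/andP: (s01 i).
have rF i : r i <= F r i.
  apply: r_le => s Ps; apply: le_trans (Ps.2 i) _.
  by apply: Fmono => j; exact: r_ub.
exists r => // i; apply/le_anti; rewrite rF andbT.
by apply: r_ub; split; [exact: Fcube | exact: Fmono].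
Qed.

(** The flow on each arc is scaled by [rho], the fraction of what enters the
    end node of that arc which ultimately stays in [S]. At a node with inflow
    [In] and outflow [Out] this fraction is the part of [max In Out] that goes
    on into arcs whose content ends in [S], or stays there if the node is in
    [S]. These equations make the balance of the scaled flow what is claimed. *)
Lemma exists_conformal_part (R : realType) nv na (G : network nv na)
    (z : 'cV[R]_na) (S : pred 'I_nv) :
  exists w : 'cV[R]_na,
    (forall a, exists2 t, 0 <= t <= 1 & w a 0 = t * z a 0) /\
    forall i, let zi := (incidence R G *m z) i 0 in
              let wi := (incidence R G *m w) i 0 in
      (0 <= zi -> wi = (S i)%:R * zi) /\ (zi <= 0 -> zi <= wi <= 0).
Proof.
(* Arcs with z a < 0 are used backwards. *)
pose dst a := if 0 <= z a 0 then arc_head G a else arc_tail G a.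
pose src a := if 0 <= z a 0 then arc_tail G a else arc_head G a.
have TE (r : 'I_na -> R) i :
    (incidence R G *m \col_a (r a * z a 0)) i 0 =
    \sum_(a | dst a == i) `|z a 0| * r a - \sum_(a | src a == i) `|z a 0| * r a.
  rewrite mxE [X in _ = X - _]big_mkcond [X in _ = _ - X]big_mkcond -sumrB.
  apply: eq_bigr => a _.
  rewrite !mxE /dst /src; have := arc_tail_neq_head G a.
  rewrite ![i == _]eq_sym; case: ger0P => za;
    case: (eqVneq (arc_tail G a) i) => [ti|_];
    case: (eqVneq (arc_head G a) i) => [hi|_];
    rewrite ?ti ?hi ?eqxx//= => _; ring.
pose In i := \sum_(a | dst a == i) `|z a 0|.
pose Out i := \sum_(a | src a == i) `|z a 0|.
have zE i : (incidence R G *m z) i 0 = In i - Out i.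
  have zcol : z = \col_a (1 * z a 0) by apply/colP => a; rewrite mxE mul1r.
  by rewrite [in LHS]zcol TE; congr (_ - _); apply: eq_bigr => a _; rewrite mulr1.
have In_ge0 i : 0 <= In i by apply: sumr_ge0.
have Out_ge0 i : 0 <= Out i by apply: sumr_ge0.
pose N (rho : 'I_nv -> R) i := \sum_(a | src a == i) `|z a 0| * rho (dst a).
pose F rho i :=
  (N rho i + Num.max 0 (In i - Out i) * (S i)%:R) / Num.max (In i) (Out i).
have N_bounds rho i : (forall j, 0 <= rho j <= 1) -> 0 <= N rho i <= Out i.
  move=> rho01; apply/andP; split.
    by apply: sumr_ge0 => a _; rewrite mulr_ge0//; case/andP: (rho01 (dst a)).
  apply: ler_sum => a _; rewrite ler_piMr//.
  by case/andP: (rho01 (dst a)).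
have M_ge0 i : 0 <= Num.max (In i) (Out i) by rewrite le_max In_ge0.
have num_bounds rho i : (forall j, 0 <= rho j <= 1) ->
    0 <= N rho i + Num.max 0 (In i - Out i) * (S i)%:R <= Num.max (In i) (Out i).
  move=> /(N_bounds _ i); have := In_ge0 i; have := Out_ge0 i.
  case: (leP 0 (In i - Out i)); case: (leP (In i) (Out i)); case: (S i);
    rewrite /= ?mulr1 ?mulr0 => ? ? ? ? /andP[? ?]; lra.
have [rho rho01 rhoF] : exists2 rho, (forall i, 0 <= rho i <= 1) &
    forall i, F rho i = rho i.
  apply: unit_cube_fixpoint => [rho rho01 i|rho rho' le_rho i].
    have /andP[num_ge0 num_le] := num_bounds rho i rho01.
    rewrite /F divr_ge0//=; have [->|M_neq0] := eqVneq (Num.max (In i) (Out i)) 0.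
      by rewrite invr0 mulr0 ler01.
    by rewrite ler_pdivrMr ?mul1r// lt_neqAle eq_sym M_neq0 M_ge0.
  apply: ler_wpM2r; first by rewrite invr_ge0.
  by rewrite lerD2r; apply: ler_sum => a _; exact: ler_wpM2l.
(* Multiplying out also holds at nodes where [z] vanishes on all arcs: both sides are 0. *)
have balance i : rho i * Num.max (In i) (Out i) =
    N rho i + Num.max 0 (In i - Out i) * (S i)%:R.
  have [M0|M_neq0] := eqVneq (Num.max (In i) (Out i)) 0; last first.
    by rewrite -{1}rhoF /F divfK.
  have := num_bounds rho i rho01; rewrite M0 mulr0.
  exact: le_anti.
exists (\col_a (rho (dst a) * z a 0)); split=> [a|i /=].
  by exists (rho (dst a)); rewrite ?mxE.
have -> : (incidence R G *m \col_a (rho (dst a) * z a 0)) i 0 =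
          rho i * In i - N rho i.
  rewrite TE mulr_sumr; congr (_ - _).
  by apply: eq_bigr => a /eqP ->; rewrite mulrC.
have := balance i; have := rho01 i; rewrite zE => /andP[rho_ge0 rho_le1] bal.
split=> [Out_le_In|In_le_Out].
  move: bal; rewrite max_l ?max_r//; last by rewrite -subr_ge0.
  by move=> ->; ring.
have -> : rho i * In i - N rho i = rho i * (In i - Out i).
  move: bal; rewrite max_r ?max_l//; last by rewrite -subr_le0.
  by rewrite mul0r addr0 => <-; ring.
by rewrite ler_niMl//= mulr_ge0_le0.
Qed.

(** * Supermodularity *)

(** With [A], [B], [W] the balances of [y1], [y2], [w] at a node, the pair of
    balances of [(y2 + w, y1 - w)] is [(A, B)] or [(B, A)] when [B <= A],
    according to which of [x'], [x''] has the larger demand there. When [A < B],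
    both balances are at least [A], hence above both demands. *)
Lemma feasible_exchange (R : realType) nv na (G : network nv na)
    (delta d : 'cV[R]_nv) (f : 'cV[R]_na) (x' x'' : 'cV[R]_nv) y1 y2 :
  vec_le 0 delta ->
  feasible (incidence R G) delta d f (vec_join x' x'') y1 ->
  feasible (incidence R G) delta d f (vec_meet x' x'') y2 ->
  exists y' y'', [/\ feasible (incidence R G) delta d f x' y',
    feasible (incidence R G) delta d f x'' y'' & y' + y'' = y1 + y2].
Proof.
move=> delta_ge0 [Ty1 y1_ge0 y1_le] [Ty2 y2_ge0 y2_le].
have [w [wE wP]] :=
  exists_conformal_part G (y1 - y2) (fun i => x'' i 0 < x' i 0).
have demandE x i : (d + diag_mx delta^T *m x) i 0 = d i 0 + delta i 0 * x i 0.
  by rewrite mul_diag_mx !mxE.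
have TD u v i : (incidence R G *m (u + v)) i 0 =
    (incidence R G *m u) i 0 + (incidence R G *m v) i 0.
  by rewrite mulmxDr mxE.
have TB u v i : (incidence R G *m (u - v)) i 0 =
    (incidence R G *m u) i 0 - (incidence R G *m v) i 0.
  by rewrite mulmxBr !mxE.
have joinE i : vec_join x' x'' i 0 = Num.max (x' i 0) (x'' i 0) by rewrite mxE.
have meetE i : vec_meet x' x'' i 0 = Num.min (x' i 0) (x'' i 0) by rewrite mxE.
have demandP i :
    d i 0 + delta i 0 * x' i 0 <= (incidence R G *m (y2 + w)) i 0 /\
    d i 0 + delta i 0 * x'' i 0 <= (incidence R G *m (y1 - w)) i 0.
  have := Ty1 i; have := Ty2 i; have [] := wP i.
  rewrite !demandE !TB TD joinE meetE.
  have : 0 <= delta i 0 by have := delta_ge0 i; rewrite mxE.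
  move: (_ *m y1) (_ *m y2) (_ *m w) => A B W delta_i.
  case: (leP 0 (A i 0 - B i 0)) => [AB /(_ isT) WE _|AB _ /(_ (ltW AB)) /andP[]].
    move: WE; case: (ltP (x'' i 0) (x' i 0)) => _; rewrite ?mul1r ?mul0r => *.
      by split; lra.
    by split; lra.
  case: (ltP (x'' i 0) (x' i 0)) => [/ltW|] /(ler_wpM2l delta_i) *; split; lra.
have capacity a : 0 <= y2 a 0 + w a 0 <= f a 0 /\ 0 <= y1 a 0 - w a 0 <= f a 0.
  have [t /andP[t0 t1]] := wE a; rewrite !mxE => ->.
  have := y1_ge0 a; have := y2_ge0 a; have := y1_le a; have := y2_le a.
  rewrite !mxE => *; split; apply/andP; split; nra.
exists (y2 + w), (y1 - w); split; last by rewrite addrACA subrr addr0 addrC.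
- split=> i; first by rewrite demandE; case: (demandP i).
    by rewrite !mxE; case: (capacity i) => /andP[].
  by rewrite !mxE; case: (capacity i) => /andP[].
- split=> i; first by rewrite demandE; case: (demandP i).
    by rewrite !mxE; case: (capacity i) => _ /andP[].
  by rewrite !mxE; case: (capacity i) => _ /andP[].
Qed.

Theorem proposition2 (R : realType) (nv na : nat) (G : network nv na)
    (delta : 'cV[R]_nv) (delta_ge0 : vec_le 0 delta) :
  forall (c : 'cV[R]_na) (d : 'cV[R]_nv) (f : 'cV[R]_na),
    vec_le 0 f ->
    complete_recourse (incidence R G) delta d c f (@binary_cube R nv) ->
    supermodular (@binary_cube R nv) (phi (incidence R G) delta d c f).
Proof.
move=> c d f _ recourse x' x'' Xx' Xx''.
have [Xjoin Xmeet] := binary_cube_sublattice Xx' Xx''.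
have feas x : binary_cube x -> feasible (incidence R G) delta d f x !=set0.
  by move=> /recourse[[_ [y yP _]] _]; exists y.
have [[y1 y1P ->] _] := phi_attained c (feas _ Xjoin).
have [[y2 y2P ->] _] := phi_attained c (feas _ Xmeet).
have [y' [y'' [y'P y''P y_sum]]] := feasible_exchange delta_ge0 y1P y2P.
have [_ /(_ _ y'P) le'] := phi_attained c (feas _ Xx').
have [_ /(_ _ y''P) le''] := phi_attained c (feas _ Xx'').
apply: le_trans (lerD le' le'') _.
have costD u v : (c^T *m u) 0 0 + (c^T *m v) 0 0 = (c^T *m (u + v)) 0 0.
  by rewrite mulmxDr [in RHS]mxE.
by rewrite !costD y_sum.
Qed.
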